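(* Let $(r,s)\in\mathbb{Z}\times\mathbb{N}$ with $\gcd(r,s)=1$. For $k\in\mathbb{N}_0$ let \[ \alpha_q(k)=(-1)^k q^{s\binom{k+1}{2}-rk}\,[2sk+1]\,\frac{(xq^r;q^s)_k\,(q^r/x;q^s)_k\,(q^r;q^s)_k}{(xq^s;q^s)_k\,(q^s/x;q^s)_k\,(q^s;q^s)_k}, \] and for an integer $N\geq 2$ let \[ t_q(k)=\sum_{\substack{i_1,\ldots,i_N\geq 0\\ i_1+\cdots+i_N=k}}\alpha_q(i_1)\cdots\alpha_q(i_N). \] Then for every prime $p\equiv r\pmod s$ with $r\leq p$ and $(p-r)/s\leq (p-1)/N$, \[ \sum_{k=0}^{p-1}t_q(k)\equiv q^{N(p-r)(p-s+r)/(2s)}[p]^N(-1)^{N(p-r)/s}\pmod{[p](1-xq^p)(x-q^p)}. \]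
   Context: $x$ is an indeterminate and $q$ a variable. $(a;q)_0=1$, $(a;q)_k=\prod_{j=0}^{k-1}(1-aq^j)$; $[n]=[n]_q=(1-q^n)/(1-q)$. For rational functions $A,B$ and a polynomial $P$, $A\equiv B\pmod P$ means that, writing $A-B=A_1/A_2$ in lowest terms, $P$ divides $A_1$ and $\gcd(P,A_2)=1$.
   Formalization: The factor [2sk+1] in α_q(k) is replaced by [2sk+r], with which it coincides for r=1; as printed the congruence is false, e.g. for r=2, s=5, p=7, N=2, where at x=q^7 and q→1 the left side tends to 841/16 and the right side to 49. *)

(* Defs.v *)
From mathcomp Require Import all_boot all_order all_algebra.

Set Implicit Arguments.
Unset Strict Implicit.
Unset Printing Implicit Defensive.

Import Order.TTheory GRing.Theory Num.Theory.
Local Open Scope ring_scope.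

(* Polynomials and rational functions in the two indeterminates x and q:     *)
(* x is the outer variable and q the inner one.                              *)
Notation polyxq := {poly {poly rat}}.
Notation ratxq := {fraction {poly {poly rat}}}.

Definition xP : polyxq := 'X.
Definition qP : polyxq := 'X%:P.
Definition toRat (A : polyxq) : ratxq := FracField.tofrac A.

(* The %| of polydiv on {poly {poly rat}} is pseudo-divisibility, i.e.       *)
(* divisibility over the fraction field of {poly rat}, for which [p] would   *)
(* divide everything; the congruence needs divisibility in the ring itself.  *)
Definition divides (A B : polyxq) : Prop := exists C, B = A * C.

Definition gcd_eq1 (A B : polyxq) : Prop :=
  forall D, divides D A -> divides D B -> D \is a GRing.unit.

Definition rat_cong (A B : ratxq) (P : polyxq) : Prop :=
  exists A1 A2 : polyxq,
    [/\ A2 != 0, A - B = toRat A1 / toRat A2, gcd_eq1 A1 A2,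
        divides P A1 & gcd_eq1 P A2].

Section QObjects.
Variables (F : fieldType) (q x : F).

Definition qpoch (a b : F) (k : nat) : F := \prod_(j < k) (1 - a * b ^+ j).

Definition qint (n : int) : F := (1 - q ^ n) / (1 - q).

(* The q-integer is [2sk + r]: it is the very-well-poised factor of the      *)
(* series with parameter q^r in base q^s.  With [2sk + 1] in its place the   *)
(* congruence fails for r <> 1, e.g. for (r, s, p, N) = (2, 5, 7, 2).        *)
Definition alpha (r : int) (s k : nat) : F :=
  (-1) ^+ k * q ^ ((s * 'C(k.+1, 2))%N%:Z - r * k%:Z)
  * qint ((2 * s * k)%N%:Z + r)
  * (qpoch (x * q ^ r) (q ^+ s) k * qpoch (q ^ r / x) (q ^+ s) k
     * qpoch (q ^ r) (q ^+ s) k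
     / (qpoch (x * q ^+ s) (q ^+ s) k * qpoch (q ^+ s / x) (q ^+ s) k
        * qpoch (q ^+ s) (q ^+ s) k)).

(* Each i_j is at most k because the i_j are nonnegative with sum k.         *)
Definition tcoef (r : int) (s N k : nat) : F :=
  \sum_(i : {ffun 'I_N -> 'I_k.+1} | (\sum_j i j == k)%N)
    \prod_j alpha r s (i j).

End QObjects.

(* [n] as a polynomial, for use in the modulus. *)
Definition qintP (n : nat) : polyxq := \sum_(j < n) qP ^+ j.

Lemma qintPE (n : nat) : toRat (qintP n) = qint (toRat qP) n%:Z.
Proof.
rewrite /qint -exprnP; set y := toRat qP.
have y1 : 1 - y != 0.
  rewrite /y /toRat -tofrac1 -tofracB tofrac_eq0 subr_eq0 /qP.
  apply/eqP => /(congr1 (fun P : polyxq => P`_0`_0)).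
  by rewrite !(coefC, coefX, coef1).
apply: (mulfI y1); rewrite mulrC [RHS]mulrC divfK // mulrC.
rewrite -[X in _ = X - _](expr1n _ n) subrXX; congr (_ * _).
rewrite /toRat /qintP rmorph_sum; apply: eq_bigr => i _.
by rewrite expr1n mul1r rmorphXn.
Qed.

Definition modulus (p : nat) : polyxq :=
  qintP p * (1 - xP * qP ^+ p) * (xP - qP ^+ p).

(* Main.v *)
(* Let m = (p - r)/s.  It suffices to show that the difference of the two    *)
(* sides vanishes under three specializations: x = q^p, x = q^-p, and q a    *)
(* primitive p-th root of unity; their kernels are generated by x - q^p,     *)
(* 1 - x q^p and [p], the last because the p-th cyclotomic polynomial is the *)
(* minimal polynomial of the root of unity.  Under each of them alpha_q(k)   *)
(* vanishes for m < k < p, so, as N m < p, the sum of the t_q(k) collapses   *)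
(* to the N-th power of the sum of alpha_q(k) over k <= m.  For x = q^p and  *)
(* x = q^-p that sum is a terminating very-well-poised 6phi5 series with one *)
(* parameter at infinity, which has a closed form; at a root of unity it     *)
(* vanishes because alpha_q(m - k) = - alpha_q(k).                           *)

Require Import Defs.
From Stdlib Require Import Classical.
From mathcomp Require Import all_boot all_order all_algebra all_field.
From mathcomp Require Import ring zify.

Set Implicit Arguments.
Unset Strict Implicit.
Unset Printing Implicit Defensive.

Import Order.TTheory GRing.Theory Num.Theory.
Local Open Scope ring_scope.

(** Let [D] be the difference of the two sides, written [A1 / A2] in lowest terms. A ring morphism
    at which [D] is regular with value 0 kills [A1] ([specializes_eq0]). Doing this for x = q^p, x =
    q^-p and q a primitive p-th root of unity makes [A1] divisible by the three factors of the
    modulus ([eval_x_eq0], [eval_xV_eq0], [eval_q_eq0]). Coprimality of the modulus with [A2] is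
    then inherited from that of [A1].

    The vanishing rests on two evaluations of the sum of alpha_q(k) over k <= m. At x = q^-p the
    numerator (xq^r;q^s)_k cuts the series off at m, and [series_sum_terminating] sums it by means
    of [bailey_sum]; the case x = q^p follows from the symmetry [alphaV]. At the root of unity
    (q^r;q^s)_k cuts it off, the terms k and m - k cancel ([series_sum_antisym]), and the right side
    vanishes with [p]. The passage from alpha to t, where N m < p enters, is [sum_tcoef]. *)

Section QSeries.
Variable F : fieldType.
Implicit Types (e a b c w x y z : F) (i j k m n p N s : nat) (r : int).

(** * q-shifted factorials and a terminating summation *)

Lemma qpoch0 a b : qpoch a b 0 = 1.
Proof. by rewrite /qpoch big_ord0. Qed.

Lemma qpochS a b k : qpoch a b k.+1 = qpoch a b k * (1 - a * b ^+ k).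
Proof. by rewrite /qpoch big_ord_recr. Qed.

Lemma qpochSl a b k : qpoch a b k.+1 = (1 - a) * qpoch (a * b) b k.
Proof.
rewrite /qpoch big_ord_recl expr0 mulr1; congr (_ * _).
by apply: eq_bigr => j _; rewrite -mulrA -exprS.
Qed.

Lemma qpoch_add a b n k : qpoch a b (n + k) = qpoch a b n * qpoch (a * b ^+ n) b k.
Proof.
elim: k => [|k IHk]; first by rewrite addn0 qpoch0 mulr1.
by rewrite addnS !qpochS IHk exprD !mulrA.
Qed.

Lemma qpoch_neq0 a b k :
  (forall j, (j < k)%N -> a * b ^+ j != 1) -> qpoch a b k != 0.
Proof.
by move=> h; rewrite prodf_seq_neq0; apply/allP => j _; rewrite subr_eq0 eq_sym h.
Qed.

Lemma qpoch_eq0 a b k j : (j < k)%N -> a * b ^+ j = 1 -> qpoch a b k = 0.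
Proof.
by move=> jk h; rewrite /qpoch (bigD1 (Ordinal jk)) //= h subrr mul0r.
Qed.

(** Each factor [1 - y * e^(i-m)] equals [- y * e^(i-m)] times [1 - e^(m-i) / y], and for i < k the
    latter are exactly the top k factors of [qpoch (e / y) e m]. *)
Lemma qpoch_reverse e y m k : e != 0 -> y != 0 -> (k <= m)%N ->
  qpoch (y / e ^+ m) e k * e ^+ (m * k) * qpoch (e / y) e (m - k)
  = (- y) ^+ k * e ^+ 'C(k, 2) * qpoch (e / y) e m.
Proof.
move=> e0 y0; elim: k => [|k IHk] km.
  by rewrite qpoch0 muln0 subn0 !expr0 !mul1r.
have [d dE] : exists d, (m = k.+1 + d)%N by exists (m - k.+1)%N; lia.
have e1 : (m - k.+1 = d)%N by lia.
have e2 : (m - k = d.+1)%N by lia.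
move: (IHk (ltnW km)); rewrite e1 e2 !qpochS binS bin1 mulnS exprD exprS exprD.
move=> IH; rewrite -[RHS]mulrA -[_ * qpoch _ _ m]mulrAC.
transitivity ((- y * e ^+ k) * ((- y) ^+ k * e ^+ 'C(k, 2) * qpoch (e / y) e m));
  last by ring.
rewrite -IH dE !exprD exprS.
have := expf_neq0 k e0; have := expf_neq0 d e0.
set E := e ^+ (_ * k); set u := e ^+ k; set v := e ^+ d => hv hu.
by field; rewrite e0 y0 hu hv.
Qed.

(* Bailey pair form: dividing by (e;e)_(n-k) (ae;e)_(n+k) and summing over k *)
(* gives, up to a factor independent of k, the terminating very-well-poised  *)
(* 6phi5 series with one parameter sent to infinity.                         *)
Definition bailey_term e a c k :=
  e ^+ (k ^ 2) * (a / c) ^+ k * (1 - a * e ^+ (2 * k))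
  * qpoch a e k * qpoch c e k / (qpoch e e k * qpoch (a * e / c) e k).

(* The q-WZ certificate of the recurrence in n behind [bailey_sum].          *)
Lemma bailey_partial_sum e a c n j :
  e != 0 -> c != 0 ->
  (forall i, (0 < i <= n.+1)%N -> e ^+ i != 1) ->
  (forall i, (i <= 2 * n.+1)%N -> a * e ^+ i != 1) ->
  (forall i, (0 < i <= n.+1)%N -> a * e ^+ i != c) ->
  (j <= n.+1)%N ->
  \sum_(k < j) bailey_term e a c k
     / (qpoch e e (n.+1 - k) * qpoch (a * e) e (n.+1 + k))
     * ((1 - e ^+ (n.+1 - k)) * (1 - a * e ^+ (n.+1 + k))
        - (1 - e ^+ n.+1) * (1 - a * e ^+ n.+1 / c))
  = bailey_term e a c j * e ^+ (n.+1 - j) * (1 - e ^+ j) * (1 - a * e ^+ j / c)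
    * (1 - a * e ^+ (n.+1 + j)) / (1 - a * e ^+ (2 * j))
    / (qpoch e e (n.+1 - j) * qpoch (a * e) e (n.+1 + j)).
Proof.
move=> e0 c0 he ha hc; elim: j => [|j IHj] jn.
  by rewrite big_ord0 expr0 subrr !(mulr0, mul0r).
rewrite big_ord_recr /= IHj ?(ltnW jn) //.
have [d nE] : exists d, (n.+1 = j.+1 + d)%N by exists (n.+1 - j.+1)%N; clear -jn; lia.
have e1 : (n.+1 - j.+1 = d)%N by clear -nE; lia.
have e2 : (n.+1 - j = d.+1)%N by clear -nE; lia.
have e3 : (n.+1 + j.+1 = (n.+1 + j).+1)%N by clear -nE; lia.
have q1 : qpoch e e j != 0.
  by apply: qpoch_neq0 => i ij; rewrite -exprS he //; clear -nE ij; lia.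
have q2 : qpoch (a * e / c) e j != 0.
  apply: qpoch_neq0 => i ij; apply/eqP => h.
  have /eqP[] : a * e ^+ i.+1 != c by apply: hc; clear -nE ij; lia.
  by rewrite exprS -[RHS]mul1r -h; field.
have q3 : qpoch e e d != 0.
  by apply: qpoch_neq0 => i ij; rewrite -exprS he //; clear -nE ij; lia.
have q4 : qpoch (a * e) e (n.+1 + j) != 0.
  by apply: qpoch_neq0 => i ij; rewrite -mulrA -exprS ha //; clear -nE ij; lia.
have f1 : 1 - e * e ^+ j != 0 by rewrite subr_eq0 eq_sym -exprS he //; clear -nE; lia.
have f2 : c - a * e * e ^+ j != 0.
  by rewrite subr_eq0 eq_sym -mulrA -exprS hc //; clear -nE; lia.
have f3 : 1 - e * e ^+ d != 0 by rewrite subr_eq0 eq_sym -exprS he //; clear -nE; lia.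
have f4 : 1 - a * e * e ^+ (n.+1 + j) != 0.
  by rewrite subr_eq0 eq_sym -mulrA -exprS ha //; clear -nE; lia.
have f5 : 1 - a * e ^+ (2 * j) != 0 by rewrite subr_eq0 eq_sym ha //; clear -nE; lia.
have f6 : 1 - a * e ^+ (2 * j.+1) != 0 by rewrite subr_eq0 eq_sym ha //; clear -nE; lia.
(* As n = j + d, every power of [e] is a monomial in [e], [e ^+ j], [e ^+ d] and [e ^+ (j ^ 2)], so
   the induction step becomes an identity of rational functions in these atoms. *)
have x2 : e ^+ (n.+1 + j) = e * (e ^+ j) ^+ 2 * e ^+ d.
  by rewrite -exprM -exprS -!exprD; congr (_ ^+ _); clear -nE; lia.
have x3 : e ^+ n.+1 = e * e ^+ j * e ^+ d by rewrite nE -exprS -exprD.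
have x4 : e ^+ (2 * j) = (e ^+ j) ^+ 2 by rewrite mulnC exprM.
have x5 : e ^+ (2 * j.+1) = (e * e ^+ j) ^+ 2 by rewrite mulnC exprM -exprS.
have x6 : e ^+ (j.+1 ^ 2) = e ^+ (j ^ 2) * (e ^+ j) ^+ 2 * e.
  by rewrite -exprM -exprD -exprSr; congr (_ ^+ _); clear -nE; lia.
rewrite /bailey_term e1 e2 e3 x3 x4 x5 x6; move: f4 f5 f6 q4 x2; rewrite x4 x5.
move: (n.+1 + j)%N => M f4 f5 f6 q4 x2; move: f4.
rewrite !qpochS ![_ ^+ _.+1]exprS x2 !expr0 !mulr1.
move: f1 f2 f3 f5 f6 q1 q2 q3 q4; rewrite !expr2; move: (e ^+ j) (e ^+ d) => u v.
move: (e ^+ (j ^ 2)) ((a / c) ^+ j) (qpoch a e j) (qpoch c e j) => E U A B.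
move: (qpoch e e j) (qpoch (a * e / c) e j) (qpoch e e d) (qpoch (a * e) e M).
move=> C D G H f1 f2 f3 f5 f6 q1 q2 q3 q4 f4.

field.
by rewrite ?f1 ?f2 ?f3 ?f4 ?f5 ?f6 ?q1 ?q2 ?q3 ?q4 ?c0.
Qed.

(** Call the left side S(n). The certificate yields the first-order recurrence S(n) = (1 - e^(n+1))
    (1 - a e^(n+1) / c) S(n+1), which the right side also satisfies. *)
Lemma bailey_sum e a c n :
  e != 0 -> c != 0 ->
  (forall i, (0 < i <= n)%N -> e ^+ i != 1) ->
  (forall i, (i <= 2 * n)%N -> a * e ^+ i != 1) ->
  (forall i, (0 < i <= n)%N -> a * e ^+ i != c) ->
  \sum_(k < n.+1) bailey_term e a c k
     / (qpoch e e (n - k) * qpoch (a * e) e (n + k))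
  = (1 - a) / (qpoch e e n * qpoch (a * e / c) e n).
Proof.
move=> e0 c0; elim: n => [|n IHn] he ha hc.
  by rewrite big_ord1 /bailey_term !qpoch0 !(expr0, mulr1, muln0, mul1r, invr1).
have IH := IHn _ _ _; move: IH.
set S := \sum_(k < n.+1) _ => IH.
have {IH} SE : S = (1 - a) / (qpoch e e n * qpoch (a * e / c) e n).
  by apply: IH => i hi; [apply: he | apply: ha | apply: hc]; lia.
have P := bailey_partial_sum e0 c0 he ha hc (leqnn _).
have f1 : 1 - e ^+ n.+1 != 0 by rewrite subr_eq0 eq_sym he // leqnn.
have f2 : 1 - a * e ^+ n.+1 / c != 0.
  rewrite subr_eq0 eq_sym; apply/eqP => h.
  have /eqP[] : a * e ^+ n.+1 != c by apply: hc; rewrite leqnn.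
  by rewrite -[RHS]mul1r -h divfK.
have f3 : 1 - a * e ^+ (2 * n.+1) != 0 by rewrite subr_eq0 eq_sym ha.
have {P} : \sum_(k < n.+2) bailey_term e a c k
     / (qpoch e e (n.+1 - k) * qpoch (a * e) e (n.+1 + k))
     * ((1 - e ^+ (n.+1 - k)) * (1 - a * e ^+ (n.+1 + k))
        - (1 - e ^+ n.+1) * (1 - a * e ^+ n.+1 / c)) = 0.
  (* At j = n + 1 the closed form of the partial sum is the opposite of the one remaining
     summand. *)
  rewrite big_ord_recr /= P subnn qpoch0 !expr0 addnn -mul2n subrr mul0r sub0r mul1r.
  move: f3 (bailey_term e a c n.+1) (qpoch (a * e) e (2 * n.+1))^-1.
  move: (1 - a * e ^+ (2 * n.+1)) (1 - e ^+ n.+1) => h f h0 T D.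
  by field; rewrite h0 c0.
rewrite (eq_bigr (fun k : 'I_n.+2 => bailey_term e a c k
     / (qpoch e e (n.+1 - k) * qpoch (a * e) e (n.+1 + k))
     * ((1 - e ^+ (n.+1 - k)) * (1 - a * e ^+ (n.+1 + k)))
     - bailey_term e a c k
     / (qpoch e e (n.+1 - k) * qpoch (a * e) e (n.+1 + k))
     * ((1 - e ^+ n.+1) * (1 - a * e ^+ n.+1 / c)))); last first.
  by move=> k _; rewrite mulrBr.
rewrite sumrB -mulr_suml => /eqP; rewrite subr_eq0 => /eqP.
rewrite big_ord_recr /= subnn expr0 subrr mul0r mulr0 addr0.
(* The extra factors are the last ones of the two q-factorials of level n + 1; cancelling them
   leaves the summand of level n. The summand k = n + 1 dropped out because [1 - e ^+ 0] is 0. *)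
rewrite (eq_bigr (fun k : 'I_n.+1 => bailey_term e a c k
     / (qpoch e e (n - k) * qpoch (a * e) e (n + k)))); last first.
  move=> k _; move: (bailey_term e a c k) => T.
  have -> : (n.+1 - k = (n - k).+1)%N by have := ltn_ord k; lia.
  rewrite addSn !qpochS -[a * e * _]mulrA -!exprS.
  have g1 : 1 - e ^+ (n - k).+1 != 0 by rewrite subr_eq0 eq_sym he //; lia.
  have g2 : 1 - a * e ^+ (n + k).+1 != 0.
    by rewrite subr_eq0 eq_sym ha //; have := ltn_ord k; lia.
  rewrite !invfM; move: (qpoch e e _)^-1 (qpoch (a * e) e (n + k))^-1 g1 g2.
  move: (1 - e ^+ _) (1 - a * e ^+ _) => f g X Y f0 g0.
  by field; rewrite f0 g0.
rewrite -/S SE => h.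
apply: (mulIf (mulf_neq0 f1 f2)); rewrite -h.
have x1 : a * e / c * e ^+ n = a * e ^+ n.+1 / c by rewrite exprS; ring.
rewrite !qpochS x1 -(exprS e n) !invfM.
move: (qpoch e e n)^-1 (qpoch (a * e / c) e n)^-1 => X Y.
move: f1 f2; move: (1 - e ^+ _) (1 - a * _ / c) => f g f0 g0.
by field; rewrite f0 g0.
Qed.

(** * Two evaluations of the sum of alpha_q(k) over k <= m *)

(** This is (1 - q) alpha_q(k) with e = q^s, a = q^r and w = x made independent. It is
    very-well-poised: [w * a], [a / w], [a] are paired with [e / w], [w * e], [e], each pair having
    product [a * e]. *)
Definition series_term e a w k :=
  (-1) ^+ k * e ^+ 'C(k.+1, 2) / a ^+ k * (1 - a * e ^+ (2 * k))
  * (qpoch (w * a) e k * qpoch (a / w) e k * qpoch a e k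
     / (qpoch (w * e) e k * qpoch (e / w) e k * qpoch e e k)).

Lemma bin2_mul2 k : ('C(k, 2) * 2 + k = k * k)%N.
Proof. by elim: k => // k IHk; rewrite binS bin1; lia. Qed.

Lemma alphaE y w r s k : y != 0 ->
  alpha y w r s k = series_term (y ^+ s) (y ^ r) w k / (1 - y).
Proof.
move=> y0; rewrite /alpha /series_term /qint.
have -> : y ^ ((s * 'C(k.+1, 2))%N%:Z - r * k) = (y ^+ s) ^+ 'C(k.+1, 2) / (y ^ r) ^+ k.
  by rewrite expfzDr // -exprnP exprM -exprz_inv -expfV -exprz_exp.
have -> : y ^ ((2 * s * k)%N%:Z + r) = y ^ r * (y ^+ s) ^+ (2 * k).
  by rewrite expfzDr // mulrC -exprnP -exprM; congr (_ * _ ^+ _); lia.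
by rewrite [RHS]mulrAC -!mulrA; do 3!congr (_ * _); rewrite !mulrA mulrAC.
Qed.

(** Since a = e^-(k+l), the three numerators have the shape treated by [qpoch_reverse], with y equal
    to w, 1/w and 1. The outcome is symmetric in k and l apart from [e ^+ l - e ^+ k], so exchanging
    k and l changes the sign. *)
Lemma series_term_reverse e a w k l :
  e != 0 -> w != 0 -> a * e ^+ (k + l) = 1 ->
  (forall j, (0 < j <= k + l)%N -> e ^+ j != 1) ->
  (forall j, (0 < j <= k + l)%N -> w * e ^+ j != 1) ->
  (forall j, (0 < j <= k + l)%N -> e ^+ j != w) ->
  series_term e a w k = (e ^+ l - e ^+ k) / e ^+ (2 * k * l + k + l)
    * (qpoch (w * e) e (k + l)%N / (qpoch (w * e) e k * qpoch (w * e) e l))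
    * (qpoch (e / w) e (k + l)%N / (qpoch (e / w) e k * qpoch (e / w) e l))
    * (qpoch e e (k + l)%N / (qpoch e e k * qpoch e e l)).
Proof.
move=> e0 w0 ae he hwe hew; pose h z n := qpoch z e n.
have e1 : (k + l - k = l)%N by lia.
have aE : a = (e ^+ (k + l))^-1.
  by rewrite -[LHS]mulr1 -(mulfV (expf_neq0 (k + l) e0)) mulrA ae mul1r.
have w1 : w^-1 != 0 by rewrite invr_eq0.
have R1 := qpoch_reverse e0 w0 (leq_addr l k).
have R2 := qpoch_reverse e0 w1 (leq_addr l k).
have R3 := qpoch_reverse e0 (oner_neq0 F) (leq_addr l k).
rewrite e1 -/(h _ _) in R1 R2 R3.
have H1 n : (n <= k + l)%N -> h (w * e) n != 0.
  by move=> hn; apply: qpoch_neq0 => j hj; rewrite -mulrA -exprS hwe //; lia.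
have H2 n : (n <= k + l)%N -> h (e / w) n != 0.
  move=> hn; apply: qpoch_neq0 => j hj; rewrite mulrAC -exprS.
  apply/eqP => /(congr1 (fun t => t * w)); rewrite divfK // mul1r; apply/eqP.
  by apply: hew; lia.
have H3 n : (n <= k + l)%N -> h e n != 0.
  by move=> hn; apply: qpoch_neq0 => j hj; rewrite -exprS he //; lia.
have := H1 k (leq_addr _ _); have := H2 k (leq_addr _ _).
have := H3 k (leq_addr _ _); have := H1 l (leq_addl _ _).
have := H2 l (leq_addl _ _); have := H3 l (leq_addl _ _).
move: R1 R2 R3; rewrite /series_term -!/(h _ _) aE.
rewrite !divr1 !invrK ![e * w]mulrC !mul1r [(e ^+ _)^-1 / w]mulrC exprVn invrK.
move: (h (w / _) k) (h (w^-1 / _) k) (h (e ^+ _)^-1 k) => X1 X2 X3.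
move: (h (w * e) k) (h (e / w) k) (h e k) => A1 A2 A3.
move: (h (w * e) l) (h (e / w) l) (h e l) => B1 B2 B3.
move: (h (w * e) _) (h (e / w) _) (h e _) => C1 C2 C3 R1 R2 R3 b3 b2 b1 a3 a1 a2.
have E0 := expf_neq0 ((k + l) * k) e0.
have {R1} -> : X1 = (- w) ^+ k * e ^+ 'C(k, 2) * C2 / (e ^+ ((k + l) * k) * B2).
  by rewrite -R1; field; rewrite E0 b2.
have {R2} -> : X2 = (- w^-1) ^+ k * e ^+ 'C(k, 2) * C1 / (e ^+ ((k + l) * k) * B1).
  by rewrite -R2; field; rewrite E0 b1.
have {R3} -> : X3 = (-1) ^+ k * e ^+ 'C(k, 2) * C3 / (e ^+ ((k + l) * k) * B3).
  by rewrite -R3; field; rewrite E0 b3.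
have Ew : (- w) ^+ k * (- w^-1) ^+ k = 1 by rewrite -exprMn mulrNN mulfV ?expr1n.
have Es : (-1) ^+ k * (-1) ^+ k = 1 :> F by rewrite -exprMn mulrNN mulr1 expr1n.
(* All the powers of [e] that occur are balanced by this one identity, a consequence of 2 C(k,2) + k
   = k^2. *)
have Ee : e ^+ 'C(k.+1, 2) * e ^+ ((k + l) * k) * (e ^+ 'C(k, 2)) ^+ 3
    * e ^+ (2 * k * l + k + l) = (e ^+ ((k + l) * k)) ^+ 3 * e ^+ l.
  rewrite -!exprM -!exprD; congr (_ ^+ _); rewrite binS bin1.
  by have := bin2_mul2 k; clear; lia.
have -> : 1 - (e ^+ (k + l))^-1 * e ^+ (2 * k) = (e ^+ l - e ^+ k) / e ^+ l.
  rewrite mul2n -addnn !exprD; have := expf_neq0 k e0; have := expf_neq0 l e0.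
  by move: (e ^+ k) (e ^+ l) => u v v0 u0; field; rewrite u0 v0.
rewrite -exprM.
have E1 := expf_neq0 (2 * k * l + k + l) e0; have E2 := expf_neq0 l e0.
move: E0 E1 E2 Ew Es Ee.
move: (e ^+ _ - e ^+ _) ((-1) ^+ k) ((- w) ^+ k) ((- w^-1) ^+ k) => D s1 s2 s3.
move: (e ^+ 'C(k.+1, 2)) (e ^+ ((k + l) * k)) (e ^+ 'C(k, 2)) (e ^+ l)
  (e ^+ (2 * k * l + k + l)).
move=> U V W Y Z V0 Z0 Y0 hw hs hE.
transitivity ((U * V * W ^+ 3 * Z) * (s2 * s3) * (s1 * s1) / (V ^+ 3 * Y * Z) * D
   * (C1 / (A1 * B1)) * (C2 / (A2 * B2)) * (C3 / (A3 * B3))).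
  by field; rewrite V0 Z0 Y0 a1 a2 a3 b1 b2 b3.
by rewrite hw hs hE; field; rewrite V0 Z0 Y0 a1 a2 a3 b1 b2 b3.
Qed.

(** The substitution k -> m - k turns the sum into its opposite, so twice the sum is 0. *)
Lemma series_sum_antisym e a w m :
  (2 != 0 :> F) -> e != 0 -> w != 0 -> a * e ^+ m = 1 ->
  (forall j, (0 < j <= m)%N -> e ^+ j != 1) ->
  (forall j, (0 < j <= m)%N -> w * e ^+ j != 1) ->
  (forall j, (0 < j <= m)%N -> e ^+ j != w) ->
  \sum_(k < m.+1) series_term e a w k = 0.
Proof.
move=> two0 e0 w0 ae he hwe hew.
apply: (mulfI two0); rewrite mulr0 mulr_natl mulr2n.
rewrite {2}(reindex_inj rev_ord_inj) -big_split big1 //= => k _.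
have km : (k <= m)%N by rewrite -ltnS.
have [l mE] : exists l, m = (k + l)%N by exists (m - k)%N; lia.
have -> : (m.+1 - k.+1 = l)%N by lia.
rewrite (series_term_reverse (k := k) (l := l) e0 w0) -?mE //.
rewrite (series_term_reverse (k := l) (l := k) e0 w0) ?(addnC l k) -?mE //.
have -> : (2 * l * k + l + k = 2 * k * l + k + l)%N by lia.
rewrite [qpoch (w * e) e l * _]mulrC [qpoch (e / w) e l * _]mulrC
  [qpoch e e l * _]mulrC -!mulrDl.
by rewrite -opprB addNr !mul0r.
Qed.

(** With w = (a e^m)^-1 the parameter [w * a] is e^-m, so the series terminates. Putting c = a^2
    e^m, its terms are Bailey terms up to a constant, and [bailey_sum] applies. *)
Lemma series_sum_terminating e a m :
  e != 0 -> a != 0 ->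
  (forall j, (0 < j <= m)%N -> e ^+ j != 1) ->
  (forall j, (j <= 2 * m)%N -> a * e ^+ j != 1) ->
  \sum_(k < m.+1) series_term e a (a * e ^+ m)^-1 k
  = (1 - a * e ^+ m) * (- a) ^+ m * e ^+ 'C(m, 2).
Proof.
move=> e0 a0 he ha; set c := a * (a * e ^+ m).
have em := expf_neq0 m e0.
have c0 : c != 0 by rewrite !mulf_neq0.
have hc j : (0 < j <= m)%N -> a * e ^+ j != c.
  move=> hj; apply/eqP => /(mulfI a0) h.
  have /eqP[] : a * e ^+ (m - j) != 1 by apply: ha; lia.
  apply: (mulIf (expf_neq0 j e0)); rewrite mul1r -mulrA -exprD h.
  by congr (_ * _ ^+ _); lia.
have acE : a / c = (a * e ^+ m)^-1 by rewrite /c; field; rewrite a0 em.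
have q1 : qpoch e e m != 0 by apply: qpoch_neq0 => j hj; rewrite -exprS he.
have q2 : qpoch (a * e) e m != 0.
  by apply: qpoch_neq0 => j hj; rewrite -mulrA -exprS ha //; lia.
have q3 : qpoch (a * e / c) e m != 0.
  apply: qpoch_neq0 => j hj; apply/eqP => h.
  have /eqP[] : a * e ^+ j.+1 != c by apply: hc.
  by rewrite exprS -[RHS]mul1r -h; field.
rewrite (eq_bigr (fun k : 'I_m.+1 => bailey_term e a c k
   / (qpoch e e (m - k) * qpoch (a * e) e (m + k))
   * (qpoch e e m * qpoch (a * e) e m))); last first.
  move=> k _; have km : (k <= m)%N by rewrite -ltnS.
  rewrite /series_term /bailey_term.
  have R := qpoch_reverse e0 (oner_neq0 F) km.
  have -> : (a * e ^+ m)^-1 * a = 1 / e ^+ m by field; rewrite a0 em.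
  have -> : a / (a * e ^+ m)^-1 = c by rewrite invrK.
  have -> : (a * e ^+ m)^-1 * e = a * e / c by rewrite /c; field; rewrite a0 em.
  have -> : e / (a * e ^+ m)^-1 = a * e * e ^+ m by rewrite invrK; ring.
  (* The denominator (e/w;e)_k continues (ae;e)_m to (ae;e)_(m+k), while reversing the numerator
     (e^-m;e)_k produces the (e;e)_(m-k) of the Bailey sum. *)
  rewrite qpoch_add; move: R; rewrite divr1.
  have p1 : qpoch e e k != 0.
    by apply: qpoch_neq0 => j hj; rewrite -exprS he //; lia.
  have p2 : qpoch e e (m - k) != 0.
    by apply: qpoch_neq0 => j hj; rewrite -exprS he //; lia.
  have p3 : qpoch (a * e * e ^+ m) e k != 0.
    apply: qpoch_neq0 => j hj; rewrite -!mulrA -!exprD -exprS ha //; clear -km hj; lia.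
  have p4 : qpoch (a * e / c) e k != 0.
    apply: qpoch_neq0 => j hj; apply/eqP => h.
    have /eqP[] : a * e ^+ j.+1 != c by apply: hc; clear -km hj; lia.
    by rewrite exprS -[RHS]mul1r -h; field.
  have E0 := expf_neq0 (m * k) e0.
  move: (qpoch (1 / _) e k) => X R.
  have {R} -> : X = (-1) ^+ k * e ^+ 'C(k, 2) * qpoch e e m
      / (e ^+ (m * k) * qpoch e e (m - k)) by rewrite -R; field; rewrite E0 p2.
  have Es : (-1) ^+ k * (-1) ^+ k = 1 :> F by rewrite -exprMn mulrNN mulr1 expr1n.
  have Ee : e ^+ (k ^ 2) = e ^+ 'C(k.+1, 2) * e ^+ 'C(k, 2).
    rewrite -exprD; congr (_ ^+ _); rewrite binS bin1.
    by have := bin2_mul2 k; clear; lia.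
  rewrite acE exprVn exprMn -exprM Ee.
  have A0 := expf_neq0 k a0; move: A0 E0 q1 q2 p1 p2 p3 p4 Es.
  move: (a ^+ k) (e ^+ (m * k)) (qpoch e e m) (qpoch (a * e) e m) (qpoch e e k).
  move: (qpoch e e (m - k)) (qpoch (a * e * e ^+ m) e k) (qpoch (a * e / c) e k).
  move: ((-1) ^+ k) (e ^+ 'C(k.+1, 2)) (e ^+ 'C(k, 2)) (qpoch a e k) (qpoch c e k).
  move: (1 - _) => D s U V A C G1 G2 G3 a' E' H1 H2 H3 A0 E0 q1' q2' p1 p2 p3 p4 Es.
  rewrite -[RHS]mul1r -Es.
  by field; rewrite A0 E0 q2' p1 p2 p3 p4.
rewrite -mulr_suml bailey_sum //.
have a1 : e / a != 0 by rewrite mulf_neq0 ?invr_eq0.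
(* Here [a * e / c] is y e^-m with y = e/a, so full reversal turns (ae/c;e)_m into (a;e)_m, which
   cancels against the numerator. *)
have := qpoch_reverse e0 a1 (leqnn m); rewrite subnn qpoch0 mulr1.
have -> : e / a / e ^+ m = a * e / c by rewrite /c; field; rewrite a0 em.
have -> : e / (e / a) = a by field; rewrite a0 e0.
move=> R.
have S : (1 - a) * qpoch (a * e) e m = qpoch a e m * (1 - a * e ^+ m).
  by rewrite -qpochSl qpochS.
transitivity (qpoch a e m * (1 - a * e ^+ m) / qpoch (a * e / c) e m).
  by rewrite -S; field; rewrite q1 q3.
apply: (mulIf q3); rewrite divfK //.
apply: (mulIf (expf_neq0 (m * m) e0)); rewrite -[RHS]mulrA R.
have -> : e ^+ (m * m) = e ^+ m * (e ^+ 'C(m, 2)) ^+ 2.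
  by rewrite -exprM -exprD; congr (_ ^+ _); have := bin2_mul2 m; lia.
have Ea : (- a) ^+ m * (- (e / a)) ^+ m = e ^+ m.
  by rewrite -exprMn mulrNN; congr (_ ^+ _); field.
by rewrite -Ea; ring.
Qed.

(** * From alpha to the convolution t *)

(** The range of the indices in [tcoef] varies with k; a common range ['I_p] is what allows the sum
    over k and the sum over tuples to be exchanged. *)
Lemma sum_ffun_widen N k p (f : nat -> F) : (k < p)%N ->
  \sum_(i : {ffun 'I_N -> 'I_k.+1} | (\sum_j i j == k)%N) \prod_j f (i j)
  = \sum_(i : {ffun 'I_N -> 'I_p} | (\sum_j i j == k)%N) \prod_j f (i j).
Proof.
move=> kp; pose h (i : {ffun 'I_N -> 'I_k.+1}) := [ffun j => widen_ord kp (i j)].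
(* [inord] sends values above k to 0, but the entries of a tuple with sum k are at most k, so [h']
   inverts [h] on the tuples that count. *)
pose h' (i : {ffun 'I_N -> 'I_p}) : {ffun 'I_N -> 'I_k.+1} := [ffun j => inord (i j)].
rewrite [RHS](reindex_onto h h'); last first.
  move=> i /eqP ik; apply/ffunP => j; rewrite !ffunE; apply: val_inj => /=.
  by rewrite inordK // ltnS -ik (bigD1 j) //= leq_addr.
apply: eq_big => [i|i _]; last by apply: eq_bigr => j _; rewrite ffunE.
have -> : h' (h i) = i.
  by apply/ffunP => j; rewrite !ffunE; apply: val_inj; rewrite /= inordK.
by rewrite eqxx andbT; congr (_ == _); apply: eq_bigr => j _; rewrite ffunE.
Qed.

(** The N-th power expands over all tuples in ['I_p], and the left side collects those of total less
    than p. A tuple of total at least p > N m has an entry above m, hence a zero factor. *)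
Lemma sum_tcoef y w r s N m p :
  (N * m < p)%N -> (0 < N)%N -> (forall k, (m < k < p)%N -> alpha y w r s k = 0) ->
  \sum_(0 <= k < p) tcoef y w r s N k = (\sum_(k < m.+1) alpha y w r s k) ^+ N.
Proof.
move=> Nmp N0 a0; have mp : (m < p)%N by nia.
pose f k := alpha y w r s k.
have -> : \sum_(k < m.+1) alpha y w r s k = \sum_(k < p) f k.
  rewrite (big_ord_widen_cond p xpredT) // [RHS](bigID (fun k : 'I_p => k < m.+1)%N) /=.
  rewrite [X in _ = _ + X]big1 ?addr0 // => k.
  by rewrite -leqNgt => mk; apply: a0; rewrite mk ltn_ord.
rewrite -[in RHS](card_ord N) -prodr_const bigA_distr_bigA big_mkord /=.
rewrite (eq_bigr (fun k : 'I_p => \sum_(i : {ffun 'I_N -> 'I_p} | (\sum_j i j == k)%N)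
   \prod_j f (i j))); last by move=> k _; rewrite -sum_ffun_widen.
rewrite (exchange_big_dep xpredT) //=; apply: eq_bigr => i _.
have [sp|sp] := ltnP (\sum_j i j) p.
  by rewrite (big_pred1 (Ordinal sp)) // => k; rewrite eq_sym.
rewrite big_pred0; last first.
  by move=> k; apply/negbTE; rewrite neq_ltn (leq_trans (ltn_ord k) sp) orbT.
have [j mj] : exists j : 'I_N, (m < i j)%N.
  apply/existsP; apply: contraLR sp; rewrite negb_exists -ltnNge => /forallP h.
  apply: leq_ltn_trans Nmp; rewrite -[X in (X * m)%N](card_ord N) -sum_nat_const.
  by apply: leq_sum => j _; rewrite leqNgt.
by rewrite (bigD1 j) //= /f a0 ?mul0r // mj ltn_ord.
Qed.

Lemma series_term_eq0 e a w k m :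
  (m < k)%N -> w * a * e ^+ m = 1 \/ a * e ^+ m = 1 -> series_term e a w k = 0.
Proof.
rewrite /series_term => mk [] h; first by rewrite (qpoch_eq0 mk h) !(mul0r, mulr0).
by rewrite (qpoch_eq0 mk h) !(mul0r, mulr0).
Qed.

(** Since r + s m = p and y^p = 1, the relation q^r q^(sm) = 1 holds: it kills alpha_q(k) for k > m
    and makes the remaining sum antisymmetric. *)
Lemma tcoef_sum_root y w r s N p m :
  (2 != 0 :> F) -> y != 0 -> w != 0 -> y ^+ p = 1 -> p%:Z - r = (s * m)%:Z ->
  (N * m < p)%N -> (0 < N)%N ->
  (forall j, (0 < j < p)%N -> y ^+ (s * j) != 1) ->
  (forall j, (0 < j < p)%N -> w * y ^+ (s * j) != 1) ->
  (forall j, (0 < j < p)%N -> y ^+ (s * j) != w) ->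
  \sum_(0 <= k < p) tcoef y w r s N k = 0.
Proof.
move=> two0 y0 w0 yp prm Nmp N0 hy hwy hyw; have mp : (m < p)%N by nia.
have ae : y ^ r * (y ^+ s) ^+ m = 1.
  rewrite -exprM -[y ^+ _]/(y ^ (s * m)%:Z) -expfzDr //.
  by have -> : r + (s * m)%N%:Z = p%:Z by lia.
rewrite (sum_tcoef Nmp) // => [|k /andP[mk _]]; last first.
  by rewrite alphaE // (series_term_eq0 mk) ?mul0r //; right.
rewrite (eq_bigr (fun k : 'I_m.+1 => series_term (y ^+ s) (y ^ r) w k / (1 - y))).
  rewrite -mulr_suml (series_sum_antisym two0) ?expf_neq0 ?mul0r ?expr0n //.
  - by case: (N) N0.
  - by move=> j hj; rewrite -exprM hy //; lia.
  - by move=> j hj; rewrite -exprM hwy //; lia.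
  - by move=> j hj; rewrite -exprM hyw //; lia.
by move=> k _; rewrite alphaE.
Qed.

(** This symmetry reduces x = q^p to x = q^-p. *)
Lemma alphaV y w r s k : alpha y w^-1 r s k = alpha y w r s k.
Proof.
rewrite /alpha !invrK ![_ * w^-1]mulrC ![_ * w]mulrC; congr (_ * (_ / _)).
  by rewrite [X in X * _]mulrC.
by rewrite [X in X * _]mulrC.
Qed.

Lemma tcoefV y w r s N k : tcoef y w^-1 r s N k = tcoef y w r s N k.
Proof. by apply: eq_bigr => i _; apply: eq_bigr => j _; rewrite alphaV. Qed.

Lemma tcoef_sum_terminating y r s N p m :
  y != 0 -> p%:Z - r = (s * m)%:Z -> (0 < s)%N ->
  (N * m < p)%N -> (0 < N)%N ->
  (forall j, (0 < j <= m)%N -> y ^+ (s * j) != 1) ->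
  (forall j, (j <= 2 * m)%N -> y ^ (r + (s * j)%:Z) != 1) ->
  \sum_(0 <= k < p) tcoef y (y ^+ p)^-1 r s N k
  = y ^ ((N%:Z * (p%:Z - r) * (p%:Z - s%:Z + r)) %/ (2 * s%:Z))%Z
     * qint y p%:Z ^+ N
     * (-1) ^ ((N%:Z * (p%:Z - r)) %/ s%:Z)%Z.
Proof.
move=> y0 prm s0 Nmp N0 hy hry.
have ae : y ^ r * (y ^+ s) ^+ m = y ^+ p.
  rewrite -exprM -[y ^+ (s * m)]/(y ^ (s * m)%:Z) -expfzDr //.
  by have -> : r + (s * m)%N%:Z = p%:Z by lia.
rewrite (sum_tcoef Nmp) // => [|k /andP[mk _]]; last first.
  rewrite alphaE // (series_term_eq0 mk) ?mul0r //; left.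
  by rewrite -mulrA ae mulVf ?expf_neq0.
rewrite (eq_bigr (fun k : 'I_m.+1 =>
   series_term (y ^+ s) (y ^ r) (y ^ r * (y ^+ s) ^+ m)^-1 k / (1 - y))).
  rewrite -mulr_suml series_sum_terminating ?expf_neq0 ?expfz_neq0 //.
  (* Both integer divisions in the statement are exact: p - r = s m turns the first quotient into N
     (r m + s C(m,2)) and the second into N m. *)
  - have -> : ((N%:Z * (p%:Z - r) * (p%:Z - s%:Z + r)) %/ (2 * s%:Z))%Z
       = (r * m%:Z + (s * 'C(m, 2))%:Z) * N%:Z.
      have -> : N%:Z * (p%:Z - r) * (p%:Z - s%:Z + r)
         = (r * m%:Z + (s * 'C(m, 2))%:Z) * N%:Z * (2 * s%:Z).
        have /(congr1 Posz) := bin2_mul2 m; rewrite !PoszD !PoszM => hb.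
        have -> : p%:Z = r + (s * m)%:Z by lia.
        rewrite !PoszM.
        transitivity (N%:Z * s%:Z * (m%:Z * (2 * r - s%:Z) + s%:Z * (m%:Z * m%:Z))).
          by ring.
        by rewrite -hb; ring.
      by rewrite mulzK //; lia.
    have -> : (N%:Z * (p%:Z - r) %/ s)%Z = (m * N)%:Z.
      have -> : N%:Z * (p%:Z - r) = (m * N)%:Z * s%:Z by rewrite prm !PoszM; ring.
      by rewrite mulzK //; lia.
    rewrite ae -exprz_exp expfzDr // -exprz_exp -!exprnP exprM exprM -!exprMn.
    by congr (_ ^+ _); rewrite /qint -exprnP -[- (y ^ r)]mulN1r exprMn; ring.
  - by move=> j hj; rewrite -exprM hy.
  - move=> j hj; rewrite -exprM -[y ^+ _]/(y ^ (s * j)%:Z) -expfzDr //; exact: hry.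
by move=> k _; rewrite alphaE // ae.
Qed.

End QSeries.

(** * Specializing fractions along a ring morphism *)

Section Specialization.
Variables (R : idomainType) (L : fieldType) (phi : {rmorphism R -> L}).
Local Notation tofrac := (@FracField.tofrac R).

(** The graph of the extension of [phi] to the localization of [R] at its kernel. It is a relation
    because [phi] need not extend to all fractions. *)
Definition specializes (z : {fraction R}) (l : L) :=
  exists A B, [/\ phi B != 0, z = tofrac A / tofrac B & l = phi A / phi B].

Lemma denominator_neq0 B : phi B != 0 -> tofrac B != 0.
Proof. by rewrite tofrac_eq0; apply: contraNneq => ->; rewrite rmorph0. Qed.

Lemma specializes_tofrac A : specializes (tofrac A) (phi A).
Proof.
by exists A, 1; split; rewrite ?rmorph1 ?oner_neq0 ?divr1.
Qed.

Lemma specializesD z l z' l' :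
  specializes z l -> specializes z' l' -> specializes (z + z') (l + l').
Proof.
move=> [A [B [B0 -> ->]]] [A' [B' [B'0 -> ->]]].
exists (A * B' + A' * B), (B * B'); split; first by rewrite rmorphM mulf_neq0.
- by rewrite addf_div ?denominator_neq0 // !(rmorphD, rmorphM).
- by rewrite addf_div // !(rmorphD, rmorphM).
Qed.

Lemma specializesN z l : specializes z l -> specializes (- z) (- l).
Proof.
move=> [A [B [B0 -> ->]]]; exists (- A), B; split=> //.
- by rewrite rmorphN mulNr.
- by rewrite rmorphN mulNr.
Qed.

Lemma specializesB z l z' l' :
  specializes z l -> specializes z' l' -> specializes (z - z') (l - l').
Proof. by move=> h /specializesN; apply: specializesD. Qed.

Lemma specializesM z l z' l' :
  specializes z l -> specializes z' l' -> specializes (z * z') (l * l').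
Proof.
move=> [A [B [B0 -> ->]]] [A' [B' [B'0 -> ->]]].
exists (A * A'), (B * B'); split; first by rewrite rmorphM mulf_neq0.
- by rewrite mulf_div !rmorphM.
- by rewrite mulf_div !rmorphM.
Qed.

Lemma specializesV z l : l != 0 -> specializes z l -> specializes z^-1 l^-1.
Proof.
move=> l0 [A [B [B0 zE lE]]]; have A0 : phi A != 0.
  by apply: contraNneq l0 => h; rewrite lE h mul0r.
by exists B, A; split; rewrite ?zE ?lE ?invf_div.
Qed.

Lemma specializes0 : specializes 0 0.
Proof. by have := specializes_tofrac 0; rewrite !rmorph0. Qed.

Lemma specializes1 : specializes 1 1.
Proof. by have := specializes_tofrac 1; rewrite !rmorph1. Qed.

Lemma specializes_sum (I : Type) (s : seq I) (P : pred I) f g :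
  (forall i, P i -> specializes (f i) (g i)) ->
  specializes (\sum_(i <- s | P i) f i) (\sum_(i <- s | P i) g i).
Proof. by move=> h; apply: (big_ind2 specializes specializes0 specializesD). Qed.

Lemma specializes_prod (I : Type) (s : seq I) (P : pred I) f g :
  (forall i, P i -> specializes (f i) (g i)) ->
  specializes (\prod_(i <- s | P i) f i) (\prod_(i <- s | P i) g i).
Proof. by move=> h; apply: (big_ind2 specializes specializes1 specializesM). Qed.

Lemma specializesX n z l : specializes z l -> specializes (z ^+ n) (l ^+ n).
Proof.
move=> h; elim: n => [|n IHn]; first exact: specializes1.
by rewrite !exprS; apply: specializesM.
Qed.

Lemma specializesXz (n : int) z l : l != 0 -> specializes z l -> specializes (z ^ n) (l ^ n).
Proof.
move=> l0 h; case: n => n; first exact: specializesX.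
by apply: specializesV; [rewrite expf_neq0 | apply: specializesX].
Qed.

Lemma specializes_qpoch a b a' b' k :
  specializes a a' -> specializes b b' -> specializes (qpoch a b k) (qpoch a' b' k).
Proof.
move=> ha hb; apply: specializes_prod => j _.
by apply: specializesB specializes1 (specializesM ha (specializesX j hb)).
Qed.

Lemma specializes_qint y y' n :
  y' != 0 -> y' != 1 -> specializes y y' -> specializes (qint y n) (qint y' n).
Proof.
move=> y0 y1 h; apply: specializesM.
  exact: specializesB specializes1 (specializesXz n y0 h).
apply: specializesV; first by rewrite subr_eq0 eq_sym.
exact: specializesB specializes1 h.
Qed.

Lemma specializes_tcoef y y' w w' (r : int) s N p k :
  (k < p)%N -> y' != 0 -> y' != 1 -> w' != 0 ->
  (forall j, (0 < j < p)%N -> y' ^+ (s * j) != 1) ->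
  (forall j, (0 < j < p)%N -> w' * y' ^+ (s * j) != 1) ->
  (forall j, (0 < j < p)%N -> y' ^+ (s * j) != w') ->
  specializes y y' -> specializes w w' ->
  specializes (tcoef y w r s N k) (tcoef y' w' r s N k).
Proof.
move=> kp y0 y1 w0 hy hwy hyw sy sw.
apply: specializes_sum => f _; apply: specializes_prod => i _.
have ik : (f i < p)%N by apply: leq_ltn_trans kp; rewrite -ltnS.
move: {f i}(f i : nat) ik => i ip.
have sys := specializesX s sy; have syr := specializesXz r y0 sy.
have sV := specializesV w0 sw.
apply: specializesM.
  apply: specializesM; last exact: specializes_qint.
  apply: specializesM; last exact: specializesXz.
  exact: specializesX (specializesN specializes1).
apply: specializesM.
  by do !apply: specializesM=> //; do !apply: specializes_qpoch=> //; do !apply: specializesM.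
apply: specializesV.
  rewrite !mulf_neq0 //; apply: qpoch_neq0 => j ji.
  - by rewrite -mulrA -exprM -exprD -mulnS hwy //; lia.
  - rewrite mulrAC -exprM -exprD -mulnS; apply/eqP.
    move=> /(congr1 (fun t => t * w')); rewrite divfK // mul1r; apply/eqP.
    by apply: hyw; lia.
  - by rewrite -exprM -exprD -mulnS hy //; lia.
by do !apply: specializesM=> //; do !apply: specializes_qpoch=> //; do !apply: specializesM.
Qed.

(** If [A' / B'] witnesses the specialization, then [A * B' = A' * B] with [phi A' = 0] and
    [phi B' != 0]. This reaches the numerator of any presentation of the fraction, in particular one
    in lowest terms. *)
Lemma specializes_eq0 (A B : R) :
  B != 0 -> specializes (tofrac A / tofrac B) 0 -> phi A = 0.
Proof.
move=> B0 [A' [B' [B'0 /eqP h e0]]].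
have A'0 : phi A' = 0.
  by apply/eqP; move/esym/eqP: e0; rewrite mulf_eq0 invr_eq0 (negPf B'0) orbF.
move: h; rewrite eqr_div ?(denominator_neq0 B'0) ?tofrac_eq0 // -!tofracM tofrac_eq.
move=> /eqP /(congr1 phi); rewrite !rmorphM A'0 mul0r => /eqP.
by rewrite mulf_eq0 (negPf B'0) orbF => /eqP.
Qed.
End Specialization.

(** * Lowest terms and a factor theorem in Q[q][x] *)

(** Descent on the denominator: a pair failing [gcd_eq1] has a common nonunit factor, and cancelling
    it makes the denominator smaller. *)
Lemma lowest_terms (A B : polyxq) : B != 0 ->
  exists A1 A2, [/\ A2 != 0, toRat A / toRat B = toRat A1 / toRat A2 & gcd_eq1 A1 A2].
Proof.
(* [d C - 2] is additive on products and vanishes exactly at the units.     *)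
pose d (C : polyxq) := (size C + size (lead_coef C))%N.
have [n] := ubnP (d B); elim: n => // n IHn in A B *; rewrite ltnS => dB B0.
have [|ngcd] := classic (gcd_eq1 A B); first by exists A, B.
have [D [[A' AE] [B' BE] Du]] :
    exists D, [/\ divides D A, divides D B & D \isn't a GRing.unit].
  apply: NNPP => h; apply: ngcd => D DA DB; apply/negPn/negP => Du.
  by apply: h; exists D.
move: B0; rewrite BE mulf_eq0 => /norP[D0 B'0].
have [||A1 [A2 [A20 E G]]] := IHn A' B' => //.
  apply: leq_trans dB; rewrite /d BE size_mul // lead_coefM size_mul ?lead_coef_eq0 //.
  have sD : (0 < size D)%N by rewrite size_poly_gt0.
  have sB : (0 < size B')%N by rewrite size_poly_gt0.
  have lD : (0 < size (lead_coef D))%N by rewrite size_poly_gt0 lead_coef_eq0.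
  have lB : (0 < size (lead_coef B'))%N by rewrite size_poly_gt0 lead_coef_eq0.
  suff : (2 < size D + size (lead_coef D))%N.
    move: (size D) (size B') (size (lead_coef D)) (size (lead_coef B')) sD sB lD lB.
    by lia.
  rewrite ltnNge; apply: contra Du => sz.
  have /size_poly1P[c c0 DE] : size D == 1 by apply/eqP; lia.
  have /size_poly1P[c' c'0 cE] : size c == 1.
    by move: sz lD; rewrite DE lead_coefC size_polyC c0 => sz lD; apply/eqP; lia.
  by rewrite DE cE !poly_unitE !coefC !size_polyC /= unitfE polyC_eq0 c'0.
exists A1, A2; split=> //; rewrite -E AE /toRat !tofracM -mulf_div divff ?mul1r //.
by rewrite tofrac_eq0.
Qed.

(** A factor theorem for [1 - c *: 'X], whose leading coefficient need not be a unit. Its constant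
    term is 1, so division from the low-degree end stays inside [R]. *)
Lemma horner_map_inv_eq0 (R : idomainType) (L : fieldType) (phi : {rmorphism R -> L})
    (c : R) (A : {poly R}) :
  injective phi -> c != 0 -> (map_poly phi A).[(phi c)^-1] = 0 ->
  exists C, A = (1 - c *: 'X) * C.
Proof.
move=> phi_inj c0; have [n] := ubnP (size A); elim: n => // n IHn in A *; rewrite ltnS.
have phi0 a : phi a = 0 -> a = 0 by move=> h; apply: phi_inj; rewrite h rmorph0.
have c1 : phi c != 0 by apply: contra_neq c0 => /phi0.
elim/poly_ind: A => [|A a _]; first by exists 0; rewrite mulr0.
have [->|A0] := eqVneq A 0.
  rewrite mul0r add0r map_polyC hornerC => _ /phi0 ->.
  by exists 0; rewrite mulr0.
rewrite size_MXaddC (negPf A0) /= => sA h.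
(* A X + a = (A + a c) X + a (1 - c X), so the shorter polynomial A + a c also vanishes at 1/c. *)
have [|| C CE] := IHn (A + (a * c)%:P).
- apply: leq_ltn_trans sA; rewrite (leq_trans (size_polyD _ _)) // geq_max leqnn.
  by rewrite (leq_trans (size_polyC_leq1 _)) // size_poly_gt0.
- move: h; rewrite !rmorphD /= rmorphM /= map_polyX !map_polyC /= !hornerE.
  move=> h; apply: (mulIf (invr_neq0 c1)); rewrite mul0r -{}h mulrDl rmorphM.
  by rewrite mulfK.
exists (C * 'X + a%:P); rewrite mulrDr mulrA -CE -mul_polyC polyCM; ring.
Qed.

(** * Vanishing of the difference of the two sides *)

Lemma specializes_difference (L : fieldType) (phi : {rmorphism polyxq -> L})
    (y w : L) (r a b : int) (s N p : nat) :
  y != 0 -> y != 1 -> w != 0 -> phi qP = y -> phi xP = w ->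
  (forall j, (0 < j < p)%N -> y ^+ (s * j) != 1) ->
  (forall j, (0 < j < p)%N -> w * y ^+ (s * j) != 1) ->
  (forall j, (0 < j < p)%N -> y ^+ (s * j) != w) ->
  specializes phi
    (\sum_(0 <= k < p) tcoef (toRat qP) (toRat xP) r s N k
     - toRat qP ^ a * qint (toRat qP) p%:Z ^+ N * (-1) ^ b)
    (\sum_(0 <= k < p) tcoef y w r s N k - y ^ a * qint y p%:Z ^+ N * (-1) ^ b).
Proof.
move=> y0 y1 w0 qy xw hy hwy hyw.
have sy : specializes phi (toRat qP) y by rewrite -qy; apply: specializes_tofrac.
have sw : specializes phi (toRat xP) w by rewrite -xw; apply: specializes_tofrac.
apply: specializesB.
  rewrite !big_mkord; apply: specializes_sum => k _.
  exact: (specializes_tcoef _ _ (ltn_ord k)).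
apply: specializesM; last first.
  apply: specializesXz; first by rewrite oppr_eq0 oner_neq0.
  exact: specializesN (specializes1 phi).
by apply: specializesM; [apply: specializesXz | apply/specializesX/specializes_qint].
Qed.

Lemma expr_neq_of_expz (F : fieldType) (y : F) :
  y != 0 -> (forall n : int, (y ^ n == 1) = (n == 0)) ->
  forall i j : nat, i != j -> y ^+ i != y ^+ j.
Proof.
move=> y0 yz i j ij; rewrite -subr_eq0.
have -> : y ^+ i = y ^ (i%:Z - j%:Z) * y ^+ j.
  by rewrite -[y ^+ j]/(y ^ j%:Z) -expfzDr // subrK.
rewrite -[X in _ - X]mul1r -mulrBl mulf_neq0 ?expf_neq0 // subr_eq0 yz subr_eq0.
by apply: contraNneq ij => -[->].
Qed.

Definition qcong_difference (r : int) (s N p : nat) : ratxq :=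
  \sum_(0 <= k < p) tcoef (toRat qP) (toRat xP) r s N k
  - toRat qP ^ ((N%:Z * (p%:Z - r) * (p%:Z - s%:Z + r)) %/ (2 * s%:Z))%Z
    * qint (toRat qP) p%:Z ^+ N * (-1) ^ ((N%:Z * (p%:Z - r)) %/ s%:Z)%Z.

(** As [y] is not a root of unity, nonvanishing reduces to exponents being nonzero: [s * j != p]
    protects the denominators of alpha, and [r + s * j != 0] is needed by the closed form. *)
Lemma specializes_terminating (L : fieldType) (phi : {rmorphism polyxq -> L})
    (y : L) (r : int) (s N p m : nat) :
  y != 0 -> (forall n : int, (y ^ n == 1) = (n == 0)) ->
  phi qP = y -> phi xP = y ^+ p \/ phi xP = (y ^+ p)^-1 ->
  (0 < s)%N -> p%:Z - r = (s * m)%:Z -> (N * m < p)%N -> (0 < N)%N ->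
  (forall j : nat, r + (s * j)%:Z != 0) ->
  (forall j, (0 < j < p)%N -> (s * j != p)%N) ->
  specializes phi (qcong_difference r s N p) 0.
Proof.
move=> y0 yz qy xw s0 mE Nmp N0 rs0 sjp; have yp0 := expf_neq0 p y0.
have yn (n : nat) : (y ^+ n == 1) = (n == 0%N) by exact: (yz n%:Z).
have yneq := expr_neq_of_expz y0 yz.
have y1 : y != 1 by have := yn 1%N; rewrite expr1 => ->.
have term : \sum_(0 <= k < p) tcoef y (y ^+ p)^-1 r s N k
  = y ^ ((N%:Z * (p%:Z - r) * (p%:Z - s%:Z + r)) %/ (2 * s%:Z))%Z
    * qint y p%:Z ^+ N * (-1) ^ ((N%:Z * (p%:Z - r)) %/ s%:Z)%Z.
  apply: (tcoef_sum_terminating y0 mE s0 Nmp N0) => [j hj|j _]; last by rewrite yz.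
  by rewrite yn muln_eq0; lia.
have hy j : (0 < j < p)%N -> y ^+ (s * j) != 1.
  by move=> hj; rewrite yn muln_eq0; lia.
rewrite /qcong_difference.
case: xw => xw.
  have termV : \sum_(0 <= k < p) tcoef y (y ^+ p) r s N k
      = \sum_(0 <= k < p) tcoef y (y ^+ p)^-1 r s N k.
    by apply: eq_bigr => k _; rewrite tcoefV.
  rewrite -[X in specializes _ _ X](subrr (\sum_(0 <= k < p) tcoef y (y ^+ p)^-1 r s N k)).
  rewrite -{1}termV term.
  apply: specializes_difference => // j hj; last exact/yneq/sjp.
  by rewrite -exprD yn; lia.
rewrite -[X in specializes _ _ X](subrr (\sum_(0 <= k < p) tcoef y (y ^+ p)^-1 r s N k)).
rewrite {2}term; apply: specializes_difference => //; rewrite ?invr_eq0 // => j hj.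
  apply/eqP => /(congr1 (fun t => y ^+ p * t)); rewrite mulrA mulfV // mul1r mulr1.
  by apply/eqP/yneq/sjp.
apply/eqP => /(congr1 (fun t => t * y ^+ p)); rewrite mulVf // -exprD; apply/eqP.
by rewrite yn; lia.
Qed.

(** Both sides vanish separately, the right one because [p] does. That p does not divide s keeps
    (q^s;q^s)_k nonzero for k < p. *)
Lemma specializes_root (L : fieldType) (phi : {rmorphism polyxq -> L})
    (y w : L) (r : int) (s N p m : nat) :
  (2 != 0 :> L) -> prime p -> ~~ (p %| s)%N ->
  (forall n : nat, (y ^+ n == 1) = (p %| n)%N) -> w != 0 ->
  phi qP = y -> phi xP = w ->
  p%:Z - r = (s * m)%:Z -> (N * m < p)%N -> (0 < N)%N ->
  (forall j, w * y ^+ j != 1) -> (forall j, y ^+ j != w) ->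
  specializes phi (qcong_difference r s N p) 0.
Proof.
move=> two0 pp ps yn w0 qy xw mE Nmp N0 hwy hyw.
have p0 := prime_gt0 pp; have p1 := prime_gt1 pp.
have yp : y ^+ p = 1 by apply/eqP; rewrite yn.
have y0 : y != 0.
  by apply: contra_eq_neq yp => ->; rewrite expr0n gtn_eqF // eq_sym oner_neq0.
have y1 : y != 1 by rewrite -[y]expr1 yn dvdn1; lia.
have hy j : (0 < j < p)%N -> y ^+ (s * j) != 1.
  by move=> hj; rewrite yn Euclid_dvdM // (negPf ps) /= gtnNdvd; lia.
have qp : qint y p%:Z ^+ N = 0.
  rewrite /qint -[y ^ p]/(y ^+ p) yp subrr mul0r expr0n; by case: (N) N0.
rewrite /qcong_difference.
have S0 : \sum_(0 <= k < p) tcoef y w r s N k = 0.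
  exact: tcoef_sum_root mE Nmp N0 hy _ _.
set a := (_ %/ _)%Z; set b := (_ %/ _)%Z.
have -> : 0 = \sum_(0 <= k < p) tcoef y w r s N k - y ^ a * qint y p%:Z ^+ N * (-1) ^ b.
  by rewrite S0 qp mulr0 mul0r subr0.
exact: specializes_difference.
Qed.

Lemma frac_X_expz_eq1 (n : int) :
  ((FracField.tofrac 'X : {fraction {poly rat}}) ^ n == 1) = (n == 0).
Proof.
have H k : ((FracField.tofrac 'X : {fraction {poly rat}}) ^+ k == 1) = (k == 0%N).
  rewrite -tofracXn -tofrac1 tofrac_eq; apply/eqP/eqP => [|->]; last by rewrite expr0.
  by move=> /(congr1 (fun P : {poly rat} => size P)); rewrite size_polyXn size_poly1 => -[].
by case: n => n; [exact: H | rewrite /exprz invr_eq1 H].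
Qed.

(** * The specializations and their kernels *)

Definition eval_x (c : {fraction {poly rat}}) : {rmorphism polyxq -> {fraction {poly rat}}} :=
  (horner_eval c \o map_poly (@FracField.tofrac {poly rat})).

(** x stays transcendental over [algC], so no denominator factor 1 - x z^j or 1 - z^j / x can
    vanish. *)
Definition eval_q (z : algC) : {rmorphism polyxq -> {fraction {poly algC}}} :=
  (@FracField.tofrac {poly algC} \o map_poly (horner_eval z \o map_poly (@ratr algC))).

Lemma eval_xE c : (eval_x c qP = FracField.tofrac 'X) * (eval_x c xP = c).
Proof. by rewrite /eval_x /= /horner_eval map_polyC map_polyX hornerC hornerX. Qed.

Lemma eval_qE z : (eval_q z qP = FracField.tofrac z%:P) * (eval_q z xP = FracField.tofrac 'X).
Proof. by rewrite /eval_q /= map_polyC map_polyX /= /horner_eval map_polyX hornerX. Qed.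

Lemma eval_x_eq0 (p : nat) (A : polyxq) :
  eval_x (FracField.tofrac 'X ^+ p) A = 0 -> divides (xP - qP ^+ p) A.
Proof.
rewrite /eval_x /= /horner_eval -tofracXn horner_map /= => /eqP.
rewrite tofrac_eq0 -/(root _ _) => /factor_theorem[C ->].
by exists C; rewrite mulrC /xP /qP rmorphXn.
Qed.

Lemma eval_xV_eq0 (p : nat) (A : polyxq) :
  eval_x (FracField.tofrac 'X ^+ p)^-1 A = 0 -> divides (1 - xP * qP ^+ p) A.
Proof.
rewrite /eval_x /= /horner_eval -tofracXn => /horner_map_inv_eq0[].
- by move=> a b /eqP; rewrite tofrac_eq => /eqP.
- by rewrite expf_neq0 // polyX_eq0.
by move=> C ->; exists C; rewrite /xP /qP -rmorphXn ['X * _]mulrC mul_polyC.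
Qed.

(** The minimal polynomial of [z] over the rationals divides both [f] and 1 + X + ... + X^(p-1).
    Being cyclotomic it has degree p - 1, so it is associate to the latter. *)
Lemma dvdp_prime_root_of_unity (p : nat) (z : algC) (f : {poly rat}) :
  prime p -> p.-primitive_root z -> root (map_poly ratr f) z ->
  (\sum_(j < p) 'X^j %| f)%R.
Proof.
move=> pp zp; have p0 := prime_gt0 pp.
have [g [gE _ gP]] := minCpolyP z; rewrite gP => gf.
have sS : size (\sum_(j < p) 'X^j : {poly rat}) = p.
  case: (p) p0 => // n _; rewrite big_ord_recr /= addrC size_polyDl size_polyXn //.
  rewrite ltnS; apply: leq_trans (size_sum _ _ _) _; apply/bigmax_leqP => j _.
  by rewrite size_polyXn.
have gS : g %| \sum_(j < p) 'X^j.
  rewrite -gP /root; apply/eqP.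
  have z1 : z - 1 != 0.
    rewrite subr_eq0 -(prim_order_dvd zp 1).
    by rewrite dvdn1; case: eqP pp => // ->.
  apply: (mulfI z1); rewrite mulr0 rmorph_sum horner_sum.
  under eq_bigr => j _ do rewrite rmorphXn /= map_polyX hornerXn.
  by rewrite -subrX1 (prim_expr_order zp) subrr.
have sg : size g = p.
  rewrite -(size_map_poly (ratr : {rmorphism rat -> algC})) -gE (minCpoly_cyclotomic zp).
  by rewrite size_cyclotomic totient_prime // prednK.
by rewrite -(eqp_dvdl f (_ : g %= _)) // -dvdp_size_eqp // sg sS.
Qed.

(** [p] is free of x, so divisibility is tested on each coefficient in x, a rational polynomial in q
    vanishing at [z]; the quotients assemble into the cofactor. *)
Lemma eval_q_eq0 (p : nat) (z : algC) (A : polyxq) :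
  prime p -> p.-primitive_root z -> eval_q z A = 0 -> divides (qintP p) A.
Proof.
move=> pp zp; rewrite /eval_q /= => /eqP; rewrite tofrac_eq0 => /eqP h.
pose S : {poly rat} := \sum_(j < p) 'X^j.
exists (\poly_(i < size A) (A`_i %/ S)).
have -> : qintP p = S%:P.
  by rewrite /qintP /S rmorph_sum; apply: eq_bigr => j _; rewrite rmorphXn.
apply/polyP => i; rewrite coefCM coef_poly; case: ltnP => iA; last first.
  by rewrite mulr0 nth_default.
rewrite mulrC divpK //; apply: (dvdp_prime_root_of_unity pp zp).
have := congr1 (fun P : {poly algC} => P`_i) h.
by rewrite coef_map coef0 /= => /eqP.
Qed.

(** * Assembling the three divisibilities *)

Lemma rmorph_cofactor_eq0 (R L : idomainType) (phi : {rmorphism R -> L}) (A B C : R) :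
  phi B != 0 -> phi A = 0 -> A = B * C -> phi C = 0.
Proof.
by move=> B0 A0 AE; apply/(mulfI B0); rewrite mulr0 -rmorphM -AE.
Qed.

Lemma rmorph_qintP_neq0 (L : fieldType) (phi : {rmorphism polyxq -> L}) (y : L) (p : nat) :
  phi qP = y -> y ^+ p != 1 -> phi (qintP p) != 0.
Proof.
move=> qy; apply: contra_neq; rewrite /qintP rmorph_sum => h.
apply/eqP; rewrite -subr_eq0 subrX1; apply/eqP.
suff -> : \sum_(j < p) y ^+ j = 0 by rewrite mulr0.
by rewrite -[RHS]h; apply: eq_bigr => j _; rewrite rmorphXn qy.
Qed.

Theorem theorem2 (r : int) (s N p : nat)
    (hs : (0 < s)%N) (hrs : coprimez r s%:Z) (hN : (2 <= N)%N)
    (hp : prime p) (hpr : (p%:Z = r %[mod s%:Z])%Z) (hrp : r <= p%:Z)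
    (hpN : (p%:Z - r)%:~R / s%:R <= (p%:R - 1) / N%:R :> rat) :
  let q := toRat qP in
  let x := toRat xP in
  rat_cong
    (\sum_(0 <= k < p) tcoef q x r s N k)
    (q ^ ((N%:Z * (p%:Z - r) * (p%:Z - s%:Z + r)) %/ (2 * s%:Z))%Z
     * qint q p%:Z ^+ N
     * (-1) ^ ((N%:Z * (p%:Z - r)) %/ s%:Z)%Z)
    (modulus p).
Proof.
move=> q x; have N0 : (0 < N)%N := ltnW hN.
have [m mE] : exists m : nat, p%:Z - r = (s * m)%:Z.
  move/eqP: hpr; rewrite eqz_mod_dvd => /dvdzP[k kE].
  have : 0 <= k by rewrite -(pmulr_lge0 (x := s%:Z)) // -kE subr_ge0.
  by case: k kE => // k kE _; exists k; rewrite kE mulrC PoszM.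
have Nmp : (N * m < p)%N.
  move: hpN; rewrite mE PoszM intrM -!pmulrn mulrC mulKf; last by rewrite pnatr_eq0; lia.
  by rewrite ler_pdivlMr ?ltr0n // lerBrDr -natrM natr1 ler_nat mulnC.
have p0 := prime_gt0 hp; have p1 := prime_gt1 hp.
(* If r = -s j, coprimality forces s = 1, so m = p + j >= p, against 2 m <= N m < p. *)
have rs0 j : r + (s * j)%:Z != 0.
  apply/eqP => h; have sr : (s%:Z %| r)%Z.
    by apply/dvdzP; exists (- j%:Z); rewrite -[RHS]addr0 -h PoszM; ring.
  have s1 : s = 1%N.
    move: hrs; rewrite coprimezE; move: sr; rewrite dvdzE /= => /gcdn_idPr.
    by rewrite /coprime => -> /eqP.
  have : (2 * m <= N * m)%N by rewrite leq_mul2r hN orbT.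
  by move: mE Nmp h; rewrite s1; lia.
have ps : ~~ (p %| s)%N.
  apply/negP => ps; have pr : (p %| `|r|)%N.
    have -> : r = p%:Z - (s * m)%:Z by lia.
    by rewrite -(dvdzE p%:Z) rpredB // dvdzE /= dvdn_mulr.
  have : (p %| gcdn `|r| s)%N by rewrite dvdn_gcd pr ps.
  move: hrs; rewrite coprimezE /coprime /= => /eqP ->; rewrite dvdn1 => /eqP pE.
  by move: p1; rewrite pE.
have sjp j : (0 < j < p)%N -> (s * j != p)%N.
  move=> hj; apply/eqP => h.
  have sp : (s %| p)%N by rewrite -h dvdn_mulr.
  have := primeP hp => -[_ /(_ _ sp) /orP[/eqP s1|/eqP s1]].
    by move: h; rewrite s1; lia.
  by move: ps; rewrite s1 dvdnn.
pose y : {fraction {poly rat}} := FracField.tofrac 'X.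
have y0 : y != 0 by rewrite tofrac_eq0 polyX_eq0.
have spec1 : specializes (eval_x (y ^+ p)) (qcong_difference r s N p) 0.
  apply: (specializes_terminating y0 frac_X_expz_eq1 _ _ hs mE Nmp N0 rs0 sjp).
    by rewrite eval_xE.
  by left; rewrite eval_xE.
have spec2 : specializes (eval_x (y ^+ p)^-1) (qcong_difference r s N p) 0.
  apply: (specializes_terminating y0 frac_X_expz_eq1 _ _ hs mE Nmp N0 rs0 sjp).
    by rewrite eval_xE.
  by right; rewrite eval_xE.
have [z zp] := C_prim_root_exists p0.
pose u : {fraction {poly algC}} := FracField.tofrac z%:P.
pose w : {fraction {poly algC}} := FracField.tofrac 'X.
have uX n : u ^+ n = FracField.tofrac (z ^+ n)%:P by rewrite -tofracXn polyC_exp.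
have spec3 : specializes (eval_q z) (qcong_difference r s N p) 0.
  apply: (specializes_root (y := u) (w := w) _ hp ps _ _ _ _ mE Nmp N0).
  - rewrite -(rmorph_nat (@FracField.tofrac {poly algC})) tofrac_eq0.
    by rewrite -polyC_natr polyC_eq0 pnatr_eq0.
  - move=> n; rewrite uX -tofrac1 tofrac_eq -polyC1 (inj_eq (@polyC_inj _)).
    by rewrite (prim_order_dvd zp).
  - by rewrite tofrac_eq0 polyX_eq0.
  - by rewrite eval_qE.
  - by rewrite eval_qE.
  - move=> j; rewrite uX -tofracM -tofrac1 tofrac_eq.
    apply/eqP => /(congr1 (fun P : {poly algC} => P`_0)).
    by rewrite coefXM coef1 /= => /eqP; rewrite eq_sym oner_eq0.
  move=> j; rewrite uX tofrac_eq; apply/eqP => /(congr1 (fun P : {poly algC} => P`_1)).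
  by rewrite coefC coefX /= => /eqP; rewrite eq_sym oner_eq0.
rewrite /rat_cong -/(qcong_difference r s N p).
(* Regularity at x = q^p supplies a presentation [A / B] of the difference; it is reduced, and the
   three specializations are then read on [A1]. *)
have [A [B [B0 zE _]]] := spec1.
have {}B0 : B != 0 by apply: contraNneq B0 => ->; rewrite rmorph0.
have [A1 [A2 [A20 E G]]] := lowest_terms A B0.
rewrite zE -/toRat E in spec1 spec2 spec3 *.
have e1 := specializes_eq0 A20 spec1.
have e2 := specializes_eq0 A20 spec2.
have e3 := specializes_eq0 A20 spec3.
(* The factors are peeled off one by one: a specialization killing a product but not the factor
   already removed kills the cofactor. So [p] must be nonzero at x = q^p and x = q^-p, and x - q^p
   nonzero at x = q^-p. *)
have P1 : divides (modulus p) A1.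
  have yn (n : nat) : (y ^+ n == 1) = (n == 0%N) by exact: (frac_X_expz_eq1 n%:Z).
  have pn0 : p != 0%N by rewrite -lt0n.
  have [C CE] := eval_q_eq0 hp zp e3.
  have [C' C'E] : divides (xP - qP ^+ p) C.
    apply/eval_x_eq0/(rmorph_cofactor_eq0 _ e1 CE)/(rmorph_qintP_neq0 (y := y)).
      by rewrite eval_xE.
    by rewrite yn.
  have C0 : eval_x (y ^+ p)^-1 C = 0.
    apply/(rmorph_cofactor_eq0 _ e2 CE)/(rmorph_qintP_neq0 (y := y)).
      by rewrite eval_xE.
    by rewrite yn.
  have [C'' C''E] : divides (1 - xP * qP ^+ p) C'.
    apply/eval_xV_eq0/(rmorph_cofactor_eq0 _ C0 C'E).
    rewrite rmorphB rmorphXn !eval_xE subr_eq0.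
    apply/eqP => /(congr1 (fun t => t * y ^+ p)).
    by rewrite mulVf ?expf_neq0 // -exprD; apply/eqP;
       rewrite eq_sym yn addn_eq0 negb_and pn0.
  by exists C''; rewrite /modulus CE C'E C''E !mulrA [X in _ = X * _]mulrAC.
(* A common divisor of the modulus and [A2] divides [A1] as well, hence is a unit. *)
exists A1, A2; split=> // D [D' DP] DA2; apply: G => //.
by have [C ->] := P1; exists (D' * C); rewrite DP mulrA.
Qed.
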